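(* Let $H(x,y)=\frac12y^2+F(x)$, where $F$ is a real polynomial of degree $n\ge 2$, and let the period annulus $\{\Gamma_h\mid h\in(\alpha,\beta)\}$, the separation line $L(x,y,\theta)=\sin(\theta)(x-c)-\cos(\theta)y=0$ with $0<\theta\le\pi$ and $c$ constant, and the arcs $\Gamma_h^\pm$ be as described in the context. Let $P^\pm,Q^\pm$ be polynomials in $(x,y)$ and let $$\widetilde M(h)=\int_{\Gamma_h^-}Q^-(x,y)\,\mathrm{d}x-P^-(x,y)\,\mathrm{d}y+\int_{\Gamma_h^+}Q^+(x,y)\,\mathrm{d}x-P^+(x,y)\,\mathrm{d}y,\qquad h\in(\alpha,\beta).$$ Then $\widetilde M(h)$ can be written as $$\widetilde{M}(h)=\sum_{i=0}^{n-2}p_i(h)I_{i,1}(h)+\sum_{i=0}^{n-2}q_i(h)I^+_{i,1}(h)+\sum_{i=0}^{n-2}s_{i}(h)\widetilde{K}_{i}(h),$$ where $p_i(h)$, $q_i(h)$ and $s_i(h)$, $i=0,1,\ldots,n-2$, are polynomials in $h$, and $\widetilde K_i(h)=K_{i+1,0}(h)$ if the separation line is $y=0$ (i.e. $\theta=\pi$), and $\widetilde K_i(h)=K_{0,i+1}(h)$ otherwise.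
   Context: The piecewise smooth near-Hamiltonian system under consideration is $$(\dot x,\dot y)=(H_y+\varepsilon P^\pm(x,y),\,-H_x+\varepsilon Q^\pm(x,y)),\quad (x,y)\in\Sigma^\pm,\qquad |\varepsilon|\ll1,$$ where $\Sigma^\pm=\{(x,y)\in\mathbb{R}^2\mid \pm L(x,y,\theta)>0\}$. Standing assumptions: the unperturbed system ($\varepsilon=0$), $\dot x=H_y,\ \dot y=-H_x$, has a continuous period annulus $\{\Gamma_h\mid h\in(\alpha,\beta)\}$, where $\Gamma_h\subset H^{-1}(h)$ is a periodic orbit; and the separation line $L(x,y,\theta)=0$ splits each $\Gamma_h$ into two nonempty connected parts $\Gamma_h^\pm=\Gamma_h\cap\Sigma^\pm$. All integrals are taken along the orbits or orbital arcs in the direction of the unperturbed flow. Notation: $$I_{i,j}(h)=\oint_{\Gamma_h}x^iy^j\,\mathrm{d}x,\qquad I_{i,j}^{+}(h)=\int_{\Gamma_h^+}x^iy^j\,\mathrm{d}x,\qquad K_{i,j}(h)=\int_{\Gamma_h^+}\mathrm{d}(x^iy^{j}).$$ Thus if $\Gamma_h^+$ goes from $(x_1(h),y_1(h))$ to $(x_2(h),y_2(h))$, then $K_{i,j}(h)=x_2^i(h)y_2^j(h)-x_1^i(h)y_1^j(h)$. *)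

(* Defs.v *)
From HB Require Import structures.
From mathcomp Require Import all_boot all_order all_algebra.
From mathcomp Require Import all_classical all_reals all_analysis.

Set Implicit Arguments.
Unset Strict Implicit.
Unset Printing Implicit Defensive.

Import Order.TTheory GRing.Theory Num.Theory.
Import numFieldTopology.Exports numFieldNormedType.Exports.

Local Open Scope classical_set_scope.
Local Open Scope ring_scope.

Section Planar.
Context {R : realType}.
Implicit Types (f g G : R -> R -> R) (gamma : R -> R * R) (T : R).

Definition partial_x f (x y : R) : R := derive1 (fun u : R => f u y) x.
Definition partial_y f (x y : R) : R := derive1 (fun v : R => f x v) y.

(* x' = H_y, y' = - H_x *)
Definition hamiltonian_solution G gamma : Prop :=
  forall t : R,
    is_derive t 1 (fun s => (gamma s).1)
      (partial_y G (gamma t).1 (gamma t).2) /\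
    is_derive t 1 (fun s => (gamma s).2)
      (- partial_x G (gamma t).1 (gamma t).2).

(* A constant solution has no least positive period, so equilibria are excluded. *)
Definition minimal_period gamma T : Prop :=
  [/\ 0 < T, forall t, gamma (t + T) = gamma t &
      forall s, 0 < s < T -> exists t, gamma (t + s) <> gamma t].

Definition orbit gamma : set (R * R) := range gamma.

(* Gamma h depends continuously on h in ]a, b[, for the Hausdorff distance. *)
Definition continuous_family (a b : \bar R) (Gamma : R -> set (R * R)) : Prop :=
  forall h0 : R, (a < h0%:E < b)%E -> forall e : R, 0 < e ->
    \forall h \near h0,
      (forall z, Gamma h z -> exists2 w, Gamma h0 w & ball z e w) /\
      (forall w, Gamma h0 w -> exists2 z, Gamma h z & ball w e z).

(* The orbit Gamma_h is given through a solution gamma h of least period T h;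
   the only freedom in gamma h is the choice of the point at time 0. *)
Definition continuous_period_annulus G (a b : \bar R)
    (gamma : R -> R -> R * R) (T : R -> R) : Prop :=
  (forall h : R, (a < h%:E < b)%E ->
     [/\ hamiltonian_solution G (gamma h), minimal_period (gamma h) (T h) &
         orbit (gamma h) `<=` [set z | G z.1 z.2 = h]]) /\
  continuous_family a b (fun h => orbit (gamma h)).

Definition Sigma_pos f : set (R * R) := [set z | 0 < f z.1 z.2].
Definition Sigma_neg f : set (R * R) := [set z | f z.1 z.2 < 0].

Definition splits f gamma : Prop :=
  [/\ orbit gamma `&` Sigma_pos f !=set0, connected (orbit gamma `&` Sigma_pos f),
      orbit gamma `&` Sigma_neg f !=set0 &
      connected (orbit gamma `&` Sigma_neg f)].

(* Integral of f dx + g dy along the part of the orbit of gamma lying in S, in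
   the direction of the flow: the orbit is run through once, over one period T,
   and only the times at which it is in S count. *)
Definition line_integral gamma T (S : set (R * R)) f g : R :=
  \int[lebesgue_measure]_(t in `[0, T] `&` gamma @^-1` S)
    (f (gamma t).1 (gamma t).2 * derive1 (fun s => (gamma s).1) t
     + g (gamma t).1 (gamma t).2 * derive1 (fun s => (gamma s).2) t).

Definition exact_integral gamma T S f : R :=
  line_integral gamma T S (partial_x f) (partial_y f).

Definition monomial (i j : nat) (x y : R) : R := x ^+ i * y ^+ j.

Definition I_full gamma T (i j : nat) : R :=
  line_integral gamma T setT (monomial i j) (fun _ _ => 0).

Definition I_pos f gamma T (i j : nat) : R :=
  line_integral gamma T (Sigma_pos f) (monomial i j) (fun _ _ => 0).

Definition K_pos f gamma T (i j : nat) : R :=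
  exact_integral gamma T (Sigma_pos f) (monomial i j).

(* A polynomial in (x, y) is p : {poly {poly R}}, with value p.[x, y]. *)
Definition Mtilde f gamma T (Pm Qm Pp Qp : {poly {poly R}}) : R :=
  line_integral gamma T (Sigma_neg f)
    (fun x y => Qm.[x, y]) (fun x y => - Pm.[x, y]) +
  line_integral gamma T (Sigma_pos f)
    (fun x y => Qp.[x, y]) (fun x y => - Pp.[x, y]).

Definition Ham (F : {poly R}) (x y : R) : R := 2^-1 * y ^+ 2 + F.[x].

Definition sep_line (theta c x y : R) : R :=
  sin theta * (x - c) - cos theta * y.

(* theta = pi is the line y = 0 *)
Definition Ktilde (theta c : R) gamma T (i : nat) : R :=
  if theta == pi then K_pos (sep_line theta c) gamma T i.+1 0
  else K_pos (sep_line theta c) gamma T 0 i.+1.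

End Planar.

(* Main.v *)
Require Import Defs.
From HB Require Import structures.
From mathcomp Require Import all_boot all_order all_algebra.
From mathcomp Require Import all_classical all_reals all_analysis.
From mathcomp Require Import measurable_realfun ring lra zify.
Import Order.TTheory GRing.Theory Num.Theory.
Import numFieldTopology.Exports numFieldNormedType.Exports.
Local Open Scope classical_set_scope.
Local Open Scope ring_scope.

(** Along an orbit [(x t, y t)] of [H = y^2/2 + F(x)] one has [dx = y dt] and
[dy = - F'(x) dt], so every integral in the statement is a time integral of a
polynomial over a period, restricted to the times at which
[g t = L(x t, y t)] is positive or negative, or unrestricted. Write [m i j] for
such a moment of [x^i y^j]. Having the stated form is a property of functions
of [h] that is closed under sums and under multiplication by polynomials in
[h] ([poly_submodule]), so it can be established moment by moment.

Two families of relations link the moments. On the level curve,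
[y^2 = 2 (h - F(x))], which lowers the power of [y] ([moment_level]). And the
integral of [d(x^i y^j)] is a difference of endpoint values: zero over a whole
period, and [K_{i,j}] over the positive arc. Taking [d(x^(i+1))] gives
[m i 1], and taking [d(x^l y^3)] expresses [m (l+n-1) 2] by lower moments,
because after elimination of [y^4] its coefficient [- (2l + 3n) F_n] is a
nonzero constant. What remains is [m i 2 = I_{i,1}] with [i < n-1], modulo the
[K_{i,j}] ([submod_moment]). A term [P dy] brings in moments of [F'(x) P], and
[d(x^i y^(j+1))] turns these into moments with a positive power of [y]
([submod_moment_dF]).

The [K_{i,j}] satisfy the relations of the endpoints of the arc, which lie on
the separation line and on the level curve. If the line is [y = 0], only the
[K_{i,0}] survive, and [F(x) = h] lowers [i] below [n]
([submod_endpoints_horizontal]). If it is [x = c + kappa y], every [K_{i,j}]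
is a combination of the [K_{0,l}], and [y^2/2 + F(c + kappa y) = h] lowers [l]
below the degree of the left side, which lies between 2 and [n]
([submod_endpoints_graph]). This degree could be less than 2 only for [n = 2]
and [F_2 < 0]; but then [H] is a saddle, which has no periodic orbit
([no_periodic_orbit_saddle]).

The relation of the separation line says that the integral of [(g A)'] over
[{g > 0}] vanishes for periodic continuously differentiable [g] and [A]. This
is true whatever the shape of the set [{g > 0}], because [max(g, 0) A] is
periodic and Lipschitz ([integral_pos_set_prod]). Thus the endpoints of the
arc never have to be exhibited.

Finally, integrals over [{g < 0}] are differences of integrals over the period
and over [{g > 0}], provided that [{g = 0}] is a null set
([negligible_on_line]). A function has derivative zero at almost every one of
its zeros ([negligible_noncritical_zeros]), so almost everywhere on [{g = 0}]
both [g] and [g'] vanish, and then [x t] is a root of a fixed polynomial, which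
is nonzero, again because a saddle has no periodic orbit. The level sets of
[x] are null by the same principle, since a point with [y = 0] and
[F'(x) = 0] would be an equilibrium ([no_equilibrium]). *)

(** * Integrals over a period *)

Section PeriodIntegrals.
Context {R : realType}.
Implicit Types (u du f g dg ddg A dA : R -> R) (T : R) (S : set R).
Notation mu := (@lebesgue_measure R).

Lemma continuous_of_derive u du :
  (forall t : R, is_derive t 1 u (du t)) -> continuous u.
Proof.
move=> du' t; apply: differentiable_continuous; apply/derivable1_diffP.
by have [] := du' t.
Qed.

Lemma continuous_exprn u k : continuous u -> continuous (fun t => u t ^+ k).
Proof. by move=> cu t; exact: continuous_comp (cu t) (@exprn_continuous _ k _). Qed.

Lemma continuous_mulc (a : R) f : continuous f -> continuous (fun t => a * f t).
Proof. by move=> cf t; apply: cvgM; [exact: cvg_cst|exact: cf]. Qed.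

Lemma continuous_sum m (f : nat -> R -> R) : (forall k, continuous (f k)) ->
  continuous (fun t => \sum_(k < m) f k t).
Proof.
move=> cf; elim: m => [|m IH].
  by under eq_fun do rewrite big_ord0; move=> t; exact: cvg_cst.
under eq_fun do rewrite big_ord_recr/=.
by move=> t; apply: cvgD; [exact: IH|exact: cf].
Qed.

Lemma measurable_pos_set f : continuous f -> measurable [set t | 0 < f t].
Proof.
move=> cf; apply: open_measurable.
exact: (open_comp (fun t _ => cf t) (@open_gt R 0)).
Qed.

Lemma neg_setE f : [set t | f t < 0] = [set t | 0 < - f t].
Proof. by apply/seteqP; split => t /=; rewrite oppr_gt0. Qed.

Lemma measurable_neg_set f : continuous f -> measurable [set t | f t < 0].
Proof.
move=> cf; rewrite neg_setE; apply: measurable_pos_set => t.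
by apply: cvgN; exact: cf.
Qed.

Lemma measurable_zero_set f : continuous f -> measurable [set t | f t = 0].
Proof.
move=> cf; apply: closed_measurable.
exact: (closed_comp (fun t _ => cf t) (@closed_eq R 0)).
Qed.

Lemma integrable_period T S f : continuous f -> measurable S ->
  mu.-integrable (`[0, T] `&` S) (EFin \o f).
Proof.
move=> cf mS; apply: (@integrableS _ _ _ mu `[0, T]) => //=.
  exact: measurableI.
apply: continuous_compact_integrable; first exact: segment_compact.
exact: continuous_subspaceT.
Qed.

Lemma integral_period_sum T S m (f : nat -> R -> R) : measurable S ->
  (forall k, continuous (f k)) ->
  \int[mu]_(t in `[0, T] `&` S) (\sum_(k < m) f k t) =
  \sum_(k < m) \int[mu]_(t in `[0, T] `&` S) f k t.
Proof.
move=> mS cf; have mD : measurable (`[0, T] `&` S) by exact: measurableI.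
elim: m => [|m IH].
  by under eq_Rintegral do rewrite big_ord0; rewrite big_ord0 Rintegral_cst// mul0r.
under eq_Rintegral do rewrite big_ord_recr/=.
rewrite RintegralD//; first by rewrite big_ord_recr/= IH.
- by apply: integrable_period => //; exact: continuous_sum.
- exact: integrable_period.
Qed.

Lemma integral_sign_split T f u : continuous f -> continuous u ->
  \int[mu]_(t in `[0, T]) u t =
    \int[mu]_(t in `[0, T] `&` [set t | 0 < f t]) u t
  + \int[mu]_(t in `[0, T] `&` [set t | f t < 0]) u t
  + \int[mu]_(t in `[0, T] `&` [set t | f t = 0]) u t.
Proof.
move=> cf cu.
have mp := measurable_pos_set _ cf.
have mn := measurable_neg_set _ cf.
have mz := measurable_zero_set _ cf.
have mI S : measurable S -> measurable (`[0, T] `&` S) by exact: measurableI.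
have {1}-> : `[0, T]%classic = `[0, T]%classic `&`
   (([set t | 0 < f t] `|` [set t | f t < 0]) `|` [set t | f t = 0]) :> set R.
  apply/seteqP; split => [t tT|t []//]; split => //=.
  by case: (ltgtP (f t) 0) => [|| ->]; [left; right|left; left|right].
rewrite setIUr Rintegral_setU//; first last.
- apply/disj_setPS => t [[_ /= H] [_ /= ft]].
  by move: H; rewrite ft ltxx; case.
- by rewrite -setIUr; apply: integrable_period => //; do ?apply: measurableU.
- by apply: mI; exact: mz.
- by apply: mI; exact: measurableU.
congr (_ + _); rewrite setIUr Rintegral_setU//; first last.
- apply/disj_setPS => t [[_ /= H] [_ /= ft]].
  by move: (lt_trans H ft); rewrite ltxx.
- by rewrite -setIUr; apply: integrable_period => //; do ?apply: measurableU.
- exact: mI.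
- exact: mI.
Qed.

Lemma integral_derivative_period T u du : 0 < T ->
  (forall t : R, is_derive t 1 u (du t)) -> continuous du -> u T = u 0 ->
  \int[mu]_(t in `[0, T]) du t = 0.
Proof.
move=> T0 du' cdu uT.
have cu := continuous_of_derive _ _ du'.
rewrite /Rintegral (@continuous_FTC2 _ du u) //=.
- by rewrite uT subrr.
- exact: continuous_subspaceT.
- split.
  + by move=> x _; have [] := du' x.
  + exact: cvg_at_right_filter (cu 0).
  + exact: cvg_at_left_filter (cu T).
- by move=> x _; rewrite derive1E; have [] := du' x.
Qed.

Lemma is_derive_sqr_pos_part (x : R) :
  is_derive x 1 (fun y : R => Num.max y 0 ^+ 2) (2 * Num.max x 0).
Proof.
have [x0|x0|->] := ltgtP x 0.
- apply: (@near_eq_is_derive _ _ _ (cst 0)); last first.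
    by rewrite mulr0; exact: is_derive_cst.
  near=> y; rewrite /= max_r ?expr0n//; apply: ltW.
  by near: y; apply: lt_nbhsl.
- apply: (@near_eq_is_derive _ _ _ (fun y : R => y ^+ 2)).
  + near=> y; rewrite /= max_l//; apply: ltW.
    by near: y; apply: lt_nbhsr.
  + by apply: is_derive_eq; rewrite /GRing.scale/=; ring.
- rewrite mulr0.
  have H : (fun h : R => h^-1 *: ((fun y : R => Num.max y 0 ^+ 2) (h *: 1 + 0)
      - (fun y : R => Num.max y 0 ^+ 2) 0)) @ 0^' --> (0 : R).
    apply/cvgrPdist_lt => e e0; near=> h.
    rewrite sub0r normrN /GRing.scale/= mulr1 addr0 maxxx expr0n subr0.
    have h0 : h != 0 by near: h; exact: nbhs_dnbhs_neq.
    rewrite normrM normfV ltr_pdivrMl ?normr_gt0//.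
    have he : `|h| < e.
      near: h; apply: dnbhs0_lt => //.
    have [hp|hn] := ltP 0 h.
      rewrite expr2 normrM ltr_pM2l ?normr_gt0//.
    by rewrite expr0n normr0 mulr_gt0 ?normr_gt0.
  split; first by apply: cvgP H.
  exact: cvg_lim.
Unshelve. all: by end_near.
Qed.

(** The periodic function [max(g, 0)^2 A] is continuously differentiable; its
derivative is the integrand on [{g > 0}] and zero elsewhere. *)
Lemma integral_pos_set_sqr T g dg A dA : 0 < T ->
  (forall t : R, is_derive t 1 g (dg t)) -> continuous dg -> g T = g 0 ->
  (forall t : R, is_derive t 1 A (dA t)) -> continuous dA -> A T = A 0 ->
  \int[mu]_(t in `[0, T] `&` [set t | 0 < g t])
    (2 * g t * dg t * A t + g t ^+ 2 * dA t) = 0.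
Proof.
move=> T0 dg' cdg gT dA' cdA AT.
have cg := continuous_of_derive _ _ dg'.
have cA := continuous_of_derive _ _ dA'.
have cmax : continuous (fun t => Num.max (g t) 0).
  move=> t; apply: (@continuous_max _ _ (g : R -> R^o) (fun=> 0)); first exact: cg.
  exact: cvg_cst.
rewrite Rintegral_mkcondr.
rewrite -[RHS](@integral_derivative_period T
  (fun t => Num.max (g t) 0 ^+ 2 * A t)
  (fun t => 2 * Num.max (g t) 0 * dg t * A t + Num.max (g t) 0 ^+ 2 * dA t)) //.
- apply: eq_Rintegral => t _; rewrite patchE.
  case: ifPn => [/set_mem/= gt|/negP gt].
    by rewrite max_l// ltW.
  rewrite max_r; first by rewrite expr0n !(mulr0, mul0r) addr0.
  by rewrite leNgt; apply/negP => ?; apply: gt; apply/mem_set.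
- move=> t.
  have := @is_derive1_comp _ (fun y : R => Num.max y 0 ^+ 2) g t _ _
    (is_derive_sqr_pos_part (g t)) (dg' t).
  move=> H; have H2 := @is_deriveM _ _ _ A t 1 _ _ H (dA' t).
  apply: is_derive_eq H2 _.
  by rewrite /GRing.scale/=; ring.
- move=> t; apply: cvgD; apply: cvgM.
  + apply: cvgM; last exact: cdg.
    by apply: cvgM; [exact: cvg_cst|exact: cmax].
  + exact: cA.
  + exact: (continuous_exprn _ 2 cmax).
  + exact: cdA.
- by rewrite gT AT.
Qed.

(** The function [max(g, 0) A] is periodic, but need not be differentiable where
[g] changes sign. The previous lemma applies with [A]
replaced by [g A / (g^2 + e)] and gives the same claim for
[g^3 A / (g^2 + e)], whose derivative on [{g > 0}] tends boundedly to
[(g A)'] as [e] tends to 0. *)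
Lemma integral_pos_set_prod T g dg A dA : 0 < T ->
  (forall t : R, is_derive t 1 g (dg t)) -> continuous dg -> g T = g 0 ->
  (forall t : R, is_derive t 1 A (dA t)) -> continuous dA -> A T = A 0 ->
  \int[mu]_(t in `[0, T] `&` [set t | 0 < g t]) (dg t * A t + g t * dA t) = 0.
Proof.
move=> T0 dg' cdg gT dA' cdA AT.
have cg := continuous_of_derive _ _ dg'.
have cA := continuous_of_derive _ _ dA'.
pose D := `[0, T] `&` [set t | 0 < g t].
have mpos := measurable_pos_set _ cg.
have mD : measurable D by exact: measurableI.
pose P t := dg t * A t + g t * dA t.
pose Q t := 2 * (A t * dg t).
have cP : continuous P.
  by move=> t; apply: cvgD; apply: cvgM; [exact: cdg|exact: cA|exact: cg|exact: cdA].
have cQ : continuous Q.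
  move=> t; apply: cvgM; first exact: cvg_cst.
  by apply: cvgM; [exact: cA|exact: cdg].
pose V n t := (g t ^+ 2 + harmonic n)^-1.
have h0 n : 0 < harmonic n :> R by rewrite invr_gt0.
have V0 n t : 0 < g t ^+ 2 + harmonic n by rewrite ltr_wpDl// sqr_ge0.
have cV n : continuous (V n).
  move=> t; apply: cvgV; first by rewrite gt_eqF.
  by apply: cvgD; [exact: (continuous_exprn _ 2 cg)|exact: cvg_cst].
(* The derivative of g^3 A / (g^2 + e) for e = 1 / (n + 1). *)
pose f n t := P t * (g t ^+ 2 * V n t)
  + Q t * (g t ^+ 2 * V n t) * (harmonic n * V n t).
have cf n : continuous (f n).
  have c2 : continuous (fun t => g t ^+ 2 * V n t).
    by move=> t; apply: cvgM; [exact: (continuous_exprn _ 2 cg)|exact: cV].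
  move=> t; apply: cvgD; first by apply: cvgM; [exact: cP|exact: c2].
  apply: cvgM; first by apply: cvgM; [exact: cQ|exact: c2].
  by apply: cvgM; [exact: cvg_cst|exact: cV].
have f0 n : \int[mu]_(t in D) f n t = 0.
  pose dV t := - (2 * g t * dg t) * V n t ^+ 2.
  have dV' (t : R) : is_derive t 1 (V n) (dV t).
    have V0' : (fun s : R => g s ^+ 2 + harmonic n) t != 0 by rewrite gt_eqF.
    have H : is_derive t 1 (fun s : R => g s ^+ 2 + harmonic n) (2 * g t * dg t).
      have Hg := dg' t.
      by apply: is_derive_eq; rewrite /GRing.scale/= ?addr0 ?expr1; ring.
    have := @is_deriveV _ _ t _ 1 V0' H.
    move/is_derive_eq; apply; rewrite /dV /V /GRing.scale/=.
    by rewrite exprVn; ring.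
  pose B t := g t * A t * V n t.
  pose dB t := P t * V n t + g t * A t * dV t.
  have dB' (t : R) : is_derive t 1 B (dB t).
    have := @is_deriveM _ _ _ _ t 1 _ _
       (@is_deriveM _ _ _ _ t 1 _ _ (dg' t) (dA' t)) (dV' t).
    by move/is_derive_eq; apply; rewrite /dB /P /GRing.scale/= fctE; ring.
  have cdV : continuous dV.
    move=> t; apply: cvgM; last exact: (continuous_exprn _ 2 (cV n)).
    apply: cvgN; apply: cvgM; last exact: cdg.
    by apply: cvgM; [exact: cvg_cst|exact: cg].
  have cdB : continuous dB.
    move=> t; apply: cvgD; first by apply: cvgM; [exact: cP|exact: cV].
    by apply: cvgM; [apply: cvgM; [exact: cg|exact: cA]|exact: cdV].
  have BT : B T = B 0 by rewrite /B /V gT AT.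
  rewrite -[RHS](integral_pos_set_sqr T g dg B dB T0 dg' cdg gT dB' cdB BT).
  apply: eq_Rintegral => t _.
  rewrite /f /B /dB /dV /Q /P /V.
  by move: (V0 n t); move: (harmonic n) => e ep; field; rewrite gt_eqF.
have [|||||] := @dominated_convergence _ _ R mu D mD
  (fun n => EFin \o f n) (EFin \o P) (EFin \o (fun t => `|P t| + `|Q t|)).
- move=> n; apply/measurable_EFinP; apply: measurable_funTS.
  exact: continuous_measurable_fun.
- apply/measurable_EFinP; apply: measurable_funTS.
  exact: continuous_measurable_fun.
- apply: aeW => t [_ /= gt]; apply: cvg_EFin; first exact: nearW.
  have Vc : V n t @[n --> \oo] --> (g t ^+ 2)^-1.
    apply: cvgV; first by rewrite gt_eqF// exprn_gt0.
    rewrite -[X in _ --> X]addr0; apply: cvgD; [exact: cvg_cst|exact: cvg_harmonic].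
  have V1 : (g t ^+ 2 * V n t) @[n --> \oo] --> (1 : R).
    rewrite -[X in _ --> X](@mulfV _ (g t ^+ 2)); last by rewrite gt_eqF// exprn_gt0.
    by apply: cvgM => //; exact: cvg_cst.
  have -> : P t = P t * 1 + Q t * 1 * (0 * (g t ^+ 2)^-1) by ring.
  apply: cvgD; first by apply: cvgM => //; exact: cvg_cst.
  apply: cvgM; first by apply: cvgM => //; exact: cvg_cst.
  by apply: cvgM => //; exact: cvg_harmonic.
- apply: integrable_period => // t.
  by apply: cvgD; apply: cvg_norm; [exact: cP|exact: cQ].
- apply: aeW => t n _; rewrite /= lee_fin /f.
  have ge : 0 <= g t ^+ 2 by exact: sqr_ge0.
  have r1 : 0 <= g t ^+ 2 * V n t <= 1.
    apply/andP; split; first by apply: divr_ge0 => //; exact: ltW.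
    by rewrite ler_pdivrMr// mul1r lerDl ltW.
  have r2 : 0 <= harmonic n * V n t <= 1.
    apply/andP; split; first by apply: divr_ge0; exact: ltW.
    by rewrite ler_pdivrMr// mul1r lerDr.
  have nle1 (a r : R) : 0 <= r <= 1 -> `|a * r| <= `|a|.
    move=> /andP[ra rb]; rewrite normrM (ger0_norm ra) ler_piMr//.
  rewrite (le_trans (ler_normD _ _))// lerD ?nle1//.
  by rewrite (le_trans (nle1 _ _ r2))// nle1.
move=> _ _ H; rewrite -/D /Rintegral.
suff -> : (\int[mu]_(t in D) (P t)%:E = 0)%E by [].
have Hz n : (\int[mu]_(t in D) (f n t)%:E = 0)%E.
  rewrite -[LHS]fineK; last first.
    by apply: integrable_fin_num => //; exact: integrable_period.
  by have := f0 n; rewrite /Rintegral => ->.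
rewrite -(cvg_lim _ H)//=.
under eq_fun do rewrite Hz.
exact: lim_cst.
Qed.

Lemma negligible_integral_eq0 (D : set R) u : measurable D ->
  continuous u -> mu.-integrable D (EFin \o u) ->
  (forall t, D t -> 0 <= u t) -> \int[mu]_(t in D) u t = 0 ->
  mu.-negligible (D `&` [set t | u t <> 0]).
Proof.
move=> mD cu iu u0 intu.
have mu' : measurable_fun D (EFin \o u) by case/integrableP: iu.
have : (\int[mu]_(t in D) `|(EFin \o u) t| = 0)%E.
  transitivity (\int[mu]_(t in D) (u t)%:E)%E.
    by apply: eq_integral => t /set_mem Dt; rewrite /= ger0_norm// u0.
  rewrite -[LHS]fineK; last exact: integrable_fin_num.
  by move: intu; rewrite /Rintegral => ->.
move/(ae_eq_integral_abs mu mD mu'); apply: negligibleS => t [Dt /= ut] H.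
by apply: ut; have := H Dt => -[].
Qed.

(** The integrals of [(f f')'] over a period, over [{f > 0}] and over [{f < 0}]
all vanish. Hence so does the one over [{f = 0}], where the integrand is
[f'^2]. *)
Lemma negligible_noncritical_zeros T f df ddf : 0 < T ->
  (forall t : R, is_derive t 1 f (df t)) ->
  (forall t : R, is_derive t 1 df (ddf t)) -> continuous ddf ->
  f T = f 0 -> df T = df 0 ->
  mu.-negligible (`[0, T] `&` [set t | f t = 0 /\ df t <> 0]).
Proof.
move=> T0 f' df' cddf fT dfT.
have cf := continuous_of_derive _ _ f'.
have cdf := continuous_of_derive _ _ df'.
have mz := measurable_zero_set _ cf.
pose w t := df t * df t + f t * ddf t.
have cw : continuous w.
  move=> t; apply: cvgD; apply: cvgM.
  - exact: cdf. - exact: cdf. - exact: cf. - exact: cddf.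
have csq : continuous (fun t => df t ^+ 2) by exact: continuous_exprn.
have w' (t : R) : is_derive t 1 (fun t => f t * df t) (w t).
  have := @is_deriveM _ _ _ _ t 1 _ _ (f' t) (df' t).
  by move/is_derive_eq; apply; rewrite /w /GRing.scale/=; ring.
have Hall : \int[mu]_(t in `[0, T]) w t = 0.
  by apply: integral_derivative_period T0 w' cw _; rewrite fT dfT.
have Hpos : \int[mu]_(t in `[0, T] `&` [set t | 0 < f t]) w t = 0.
  exact: integral_pos_set_prod.
have Hneg : \int[mu]_(t in `[0, T] `&` [set t | f t < 0]) w t = 0.
  rewrite neg_setE.
  have Nf (t : R) : is_derive t 1 (fun t => - f t) (- df t).
    by have := f' t => H; exact: is_deriveN.
  have Ndf (t : R) : is_derive t 1 (fun t => - df t) (- ddf t).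
    by have := df' t => H; exact: is_deriveN.
  rewrite -[RHS](@integral_pos_set_prod T _ _ _ _ T0 Nf _ _ Ndf).
  - by apply: eq_Rintegral => t _; rewrite /w; ring.
  - by move=> t; apply: cvgN; exact: cdf.
  - by rewrite fT.
  - by move=> t; apply: cvgN; exact: cddf.
  - by rewrite dfT.
have := @integral_sign_split T f w cf cw.
rewrite Hall Hpos Hneg !add0r => /esym Hz.
have Hsq : \int[mu]_(t in `[0, T] `&` [set t | f t = 0]) df t ^+ 2 = 0.
  rewrite -[RHS]Hz; apply: eq_Rintegral => t /set_mem[_ /= ft].
  by rewrite /w ft; ring.
have := @negligible_integral_eq0 (`[0, T] `&` [set t | f t = 0])
  (fun t => df t ^+ 2) _ csq _ _ Hsq.
move=> H; apply: negligibleS (H _ _ _).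
- move=> t [tT /= [ft dft]]; split; first by split.
  by move=> /eqP; rewrite /= sqrf_eq0 => /eqP.
- exact: measurableI.
- exact: integrable_period.
- by move=> t _; exact: sqr_ge0.
Qed.

End PeriodIntegrals.

Lemma lead_coef_neq0 {R : realType} (F : {poly R}) n : size F = n.+1 -> F`_n != 0.
Proof.
move=> sF; have : lead_coef F != 0 by rewrite lead_coef_eq0 -size_poly_eq0 sF.
by rewrite lead_coefE sF.
Qed.

(** * Periodic orbits *)

Record periodic_orbit {R : realType} (F : {poly R}) (x y : R -> R) (T h : R)
    : Prop := {
  orbit_period_gt0 : 0 < T;
  orbit_dx : forall t : R, is_derive t 1 x (y t);
  orbit_dy : forall t : R, is_derive t 1 y (- F^`().[x t]);
  orbit_xT : forall t, x (t + T) = x t;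
  orbit_yT : forall t, y (t + T) = y t;
  orbit_nonconstant : exists s t, (x s, y s) <> (x t, y t);
  orbit_level : forall t, Ham F (x t) (y t) = h }.
Arguments orbit_period_gt0 {R F x y T h}.
Arguments orbit_dx {R F x y T h}.
Arguments orbit_dy {R F x y T h}.
Arguments orbit_xT {R F x y T h}.
Arguments orbit_yT {R F x y T h}.
Arguments orbit_nonconstant {R F x y T h}.
Arguments orbit_level {R F x y T h}.

Section PeriodicOrbit.
Context {R : realType} {F : {poly R}} {x y : R -> R} {T h : R}.
Context (po : periodic_orbit F x y T h).
Notation mu := (@lebesgue_measure R).

Let T0 : 0 < T := orbit_period_gt0 po.
Let x' := orbit_dx po.
Let y' := orbit_dy po.
Let xT0 : x T = x 0. Proof. by rewrite -[RHS](orbit_xT po) add0r. Qed.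
Let yT0 : y T = y 0. Proof. by rewrite -[RHS](orbit_yT po) add0r. Qed.

Lemma continuous_orbit_x : continuous x.
Proof. exact: continuous_of_derive x'. Qed.

Lemma continuous_orbit_y : continuous y.
Proof. exact: continuous_of_derive y'. Qed.

Let cx := continuous_orbit_x.
Let cy := continuous_orbit_y.

Lemma continuous_sep_line theta c :
  continuous (fun t => sep_line theta c (x t) (y t)).
Proof.
move=> t; apply: cvgB; apply: cvgM; try exact: cvg_cst; last exact: cy.
by apply: cvgB; [exact: cx|exact: cvg_cst].
Qed.

Lemma is_derive_poly_orbit (P : {poly R}) (t : R) :
  is_derive t 1 (fun s => P.[x s]) (P^`().[x t] * y t).
Proof. exact: (is_derive1_comp (is_derive_poly P (x t)) (x' t)). Qed.

Lemma continuous_poly_orbit (P : {poly R}) : continuous (fun s => P.[x s]).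
Proof. exact: continuous_of_derive (is_derive_poly_orbit P). Qed.

(** The squared distance [E] to an equilibrium [(x0, 0)] satisfies [E' <= C E]
along the orbit, where [C] bounds the absolute value of
[1 - F'(x) / (x - x0)]. So [E exp(- C t)] is nonincreasing: if [E] vanishes
once, it vanishes at all later times, hence by periodicity always, and the
orbit is constant. *)
Lemma no_equilibrium t0 : y t0 = 0 -> F^`().[x t0] <> 0.
Proof.
move=> y0 /eqP/factor_theorem[G FG].
pose E t := (x t - x t0) ^+ 2 + y t ^+ 2.
pose dE t := 2 * (x t - x t0) * y t * (1 - G.[x t]).
have E' (t : R) : is_derive t 1 E (dE t).
  have Hx := x' t; have Hy := y' t.
  apply: is_derive_eq; rewrite /GRing.scale/= /dE FG hornerM hornerXsubC.
  by rewrite ?expr1 ?addr0 ?subr0; ring.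
have E0 t : 0 <= E t by rewrite addr_ge0// sqr_ge0.
have Elt t : t0 < t -> E t = 0.
  move=> t0t.
  have cG : continuous (fun s => `|1 - G.[x s]|).
    move=> s; apply: cvg_norm; apply: cvgB; first exact: cvg_cst.
    exact: continuous_poly_orbit.
  have [c _ Hc] := EVT_max (ltW t0t) (continuous_subspaceT cG).
  pose C := `|1 - G.[x c]|.
  pose W s := E s * expR (- C * s).
  pose dW s := (dE s - C * E s) * expR (- C * s).
  have W' (s : R) : is_derive s 1 W (dW s).
    have HE := E' s; apply: is_derive_eq.
    by rewrite /GRing.scale/= /dW; ring.
  have dW0 s : s \in `]t0, t[ -> dW s <= 0.
    move=> st; apply: mulr_le0_ge0; last exact: expR_ge0.
    have {}Hc : `|1 - G.[x s]| <= C by apply: Hc; apply: subset_itv_oo_cc st.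
    rewrite subr_le0 (le_trans (ler_norm _))// /dE normrM mulrC.
    apply: ler_pM => //.
    rewrite /E; move: (x s - x t0) (y s) => u v.
    have := sqr_ge0 (u - v); have := sqr_ge0 (u + v).
    by rewrite ler_norml => ? ?; apply/andP; split; nra.
  have : W t <= W t0.
    apply: (@ler0_derive1_nincr _ W t0 t) => //.
    - by move=> s st; rewrite derive1E; have [_ ->] := W' s; exact: dW0.
    - apply: continuous_subspaceT; exact: continuous_of_derive W'.
    - exact: ltW.
  rewrite /W {2}/E y0 subrr expr0n/= addr0 mul0r => WE.
  apply/eqP; rewrite eq_le E0 andbT.
  by move: WE; rewrite pmulr_lle0// expR_gt0.
have per k t : E (t + k%:R * T) = E t.
  elim: k t => [|k IH] t; first by rewrite mul0r addr0.
  by rewrite mulrSr mulrDl mul1r addrA /E (orbit_xT po) (orbit_yT po) -/(E _) IH.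
have Eall t : E t = 0.
  have [k] : exists k : nat, t0 < t + k%:R * T.
    exists (Num.bound `|(t0 - t) / T|).
    rewrite -ltrBlDl -ltr_pdivrMr//.
    exact: le_lt_trans (ler_norm _) (archi_boundP (normr_ge0 _)).
  by move/Elt; rewrite per.
have xy t : (x t, y t) = (x t0, 0).
  have := Eall t; rewrite /E => /eqP; rewrite paddr_eq0 ?sqr_ge0// !sqrf_eq0.
  by rewrite subr_eq0 => /andP[/eqP -> /eqP ->].
by have [s [t]] := orbit_nonconstant po; rewrite !xy.
Qed.

(** Almost everywhere on this set [x' = y] vanishes, and almost everywhere on
[{y = 0}] so does [y' = - F'(x)]; both vanish only at an equilibrium. *)
Lemma negligible_x_eq a : mu.-negligible (`[0, T] `&` [set t | x t = a]).
Proof.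
have c0 : continuous (fun t => - F^`().[x t]).
  by move=> t; apply: cvgN; exact: continuous_poly_orbit.
have xa (t : R) : is_derive t 1 (fun s => x s - a) (y t).
  by have Hx := x' t; apply: is_derive_eq; rewrite subr0.
have y2 (t : R) : is_derive t 1 (fun s => - F^`().[x s])
    (- (F^`()^`().[x t] * y t)).
  by have H := is_derive_poly_orbit F^`() t; exact: is_deriveN.
have c2 : continuous (fun t => - (F^`()^`().[x t] * y t)).
  move=> t; apply: cvgN; apply: cvgM; [exact: continuous_poly_orbit|exact: cy].
have N1 := @negligible_noncritical_zeros _ T _ _ _ T0 xa y' c0.
have N2 := @negligible_noncritical_zeros _ T _ _ _ T0 y' y2 c2.
apply: negligibleS (negligibleU (N1 _ _) (N2 _ _)); rewrite ?xT0 ?yT0//.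
move=> t [tT /= xt].
have [yt|/eqP yt] := eqVneq (y t) 0; last by left; split => //=; rewrite xt subrr.
right; split => //=; split => //.
by move=> /eqP; rewrite oppr_eq0 => /eqP; exact: no_equilibrium.
Qed.

Lemma negligible_root_orbit (P : {poly R}) : P != 0 ->
  mu.-negligible (`[0, T] `&` [set t | P.[x t] = 0]).
Proof.
have [m] := ubnP (size P); elim: m P => // m IH P sP P0.
have [[a Pa]|noroot] := pselect (exists a, root P a); last first.
  apply: negligibleS (negligible_set0 mu) => t [_ /= Pt].
  by case: noroot; exists (x t); apply/rootP.
have /factor_theorem[Q PQ] := Pa.
have Q0 : Q != 0 by apply: contraNneq P0 => Q0; rewrite PQ Q0 mul0r.
have sQ : (size Q < m)%N.
  by move: sP; rewrite PQ size_Mmonic ?monicXsubC// size_XsubC addn2.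
apply: negligibleS (negligibleU (negligible_x_eq a) (IH Q sQ Q0)).
move=> t [tT /=]; rewrite PQ hornerM hornerXsubC => /eqP.
rewrite mulf_eq0 subr_eq0 => /orP[/eqP|/eqP]; first by right.
by left.
Qed.

(** Otherwise the periodic function [(x - c) y] would have the derivative
[y^2 - a (x - c)^2], which is positive away from equilibria. *)
Lemma no_periodic_orbit_saddle a c : a < 0 -> F^`() <> a *: ('X - c%:P).
Proof.
move=> a0 Fa.
have Fx z : F^`().[z] = a * (z - c) by rewrite Fa hornerZ hornerXsubC.
pose w t := y t ^+ 2 - a * (x t - c) ^+ 2.
have w' (t : R) : is_derive t 1 (fun s => (x s - c) * y s) (w t).
  have Hx := x' t; have Hy := y' t.
  by apply: is_derive_eq; rewrite /GRing.scale/= /w Fx; ring.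
have cxc : continuous (fun t => x t - c).
  by move=> t; apply: cvgB; [exact: cx|exact: cvg_cst].
have cw : continuous w.
  move=> t; apply: cvgB; first exact: (continuous_exprn _ 2 cy).
  apply: cvgM; [exact: cvg_cst|exact: (continuous_exprn _ 2 cxc)].
have w0 t : 0 < w t.
  have aN : 0 < - a by rewrite oppr_gt0.
  have ywge := sqr_ge0 (y t); have xwge := sqr_ge0 (x t - c).
  rewrite /w -mulNr.
  have [xt|xt] := eqVneq (x t - c) 0.
    rewrite xt expr0n mulr0 addr0 lt_neqAle sqr_ge0 andbT eq_sym sqrf_eq0.
    by apply/eqP => yt; apply: (no_equilibrium t yt); rewrite Fx xt mulr0.
  by apply: ltr_wpDl => //; rewrite mulr_gt0// exprn_even_gt0.
have wint : \int[mu]_(t in `[0, T]) w t = 0.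
  by apply: (integral_derivative_period _ _ _ T0 w' cw); rewrite xT0 yT0.
have iw : mu.-integrable `[0, T] (EFin \o w).
  by rewrite -[X in mu.-integrable X _]setIT; exact: integrable_period.
have := @negligible_integral_eq0 _ `[0, T]%classic w _ cw iw
  (fun t _ => ltW (w0 t)) wint.
move=> /(_ (measurable_itv _)); rewrite (_ : _ `&` _ = `[0, T]%classic); last first.
  by apply/seteqP; split => [t []//|t tT]; split => //=; apply/eqP; rewrite gt_eqF.
move=> N; have : mu `[0, T]%classic = 0%E.
  exact: (@measure_negligible _ _ _ mu _ (measurable_itv `[0, T]) N).
rewrite lebesgue_measure_itv/= lte_fin T0 oppr0 adde0 => /eqP.
by rewrite eqe gt_eqF.
Qed.

(** Eliminating [y] between [g = 0] and [g' = 0] gives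
[sin^2 (x - c) + cos^2 F'(x) = 0]. As a polynomial in [x] this is nonzero:
otherwise [F'] would be a negative multiple of ['X - c]. *)
Lemma negligible_on_line n theta c : (2 <= n)%N -> size F = n.+1 ->
  mu.-negligible (`[0, T] `&` [set t | sep_line theta c (x t) (y t) = 0]).
Proof.
move=> n2 sF; pose s := sin theta; pose k := cos theta.
have sk : s ^+ 2 + k ^+ 2 = 1 by rewrite addrC cos2Dsin2.
have dFn0 : F^`() != 0.
  have : F^`()`_n.-1 != 0.
    rewrite coef_deriv prednK 1?ltnW// mulrn_eq0 negb_or -lt0n ltnW//=.
    exact: lead_coef_neq0.
  by apply: contraNneq => ->; rewrite coef0.
pose g t := s * (x t - c) - k * y t.
pose dg t := s * y t + k * F^`().[x t].
pose ddg t := - (s * F^`().[x t]) + k * (F^`()^`().[x t] * y t).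
have g' (t : R) : is_derive t 1 g (dg t).
  have Hx := x' t; have Hy := y' t.
  by apply: is_derive_eq; rewrite /GRing.scale/= /dg; ring.
have dg' (t : R) : is_derive t 1 dg (ddg t).
  have Hy := y' t; have HF := is_derive_poly_orbit F^`() t.
  by apply: is_derive_eq; rewrite /GRing.scale/= /ddg; ring.
have cddg : continuous ddg.
  move=> t; apply: cvgD; first apply: cvgN.
    by apply: cvgM; [exact: cvg_cst|exact: continuous_poly_orbit].
  apply: cvgM; first exact: cvg_cst.
  by apply: cvgM; [exact: continuous_poly_orbit|exact: cy].
pose P := s ^+ 2 *: ('X - c%:P) + k ^+ 2 *: F^`().
have P0 : P != 0.
  apply/eqP => P0.
  have [k0|k0] := eqVneq k 0.
    move: P0; rewrite /P; move: sk; rewrite k0 expr0n/= addr0 => ->.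
    by rewrite scale1r scale0r addr0 => /eqP; rewrite polyXsubC_eq0.
  have dFE : F^`() = (- (s ^+ 2 / k ^+ 2)) *: ('X - c%:P).
    apply: (@scalerI _ _ (k ^+ 2)); first by rewrite expf_neq0.
    move/eqP: P0; rewrite /P addrC addr_eq0 => /eqP ->.
    by rewrite scalerA mulrN mulrCA mulfV ?expf_neq0// mulr1 scaleNr.
  apply: (no_periodic_orbit_saddle _ c _ dFE).
  rewrite oppr_lt0 divr_gt0// ?exprn_even_gt0//.
  apply: contraNneq dFn0 => s0.
  by rewrite dFE s0 expr0n/= mul0r oppr0 scale0r.
have N := @negligible_noncritical_zeros _ T _ _ _ T0 g' dg' cddg.
apply: negligibleS (negligibleU (N _ _) (negligible_root_orbit _ P0)).
- move=> t [tT /=]; rewrite /sep_line -/s -/k => gt.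
  have [dgt|/eqP dgt] := eqVneq (dg t) 0; last by left.
  right; split => //=.
  rewrite /P hornerD !hornerZ hornerXsubC.
  have -> : s ^+ 2 * (x t - c) + k ^+ 2 * F^`().[x t] =
    s * (s * (x t - c) - k * y t) + k * dg t by rewrite /dg; ring.
  by rewrite gt dgt !mulr0 addr0.
- by rewrite /g xT0 yT0.
- by rewrite /dg xT0 yT0.
Qed.

End PeriodicOrbit.

Lemma partial_x_Ham {R : realType} (F : {poly R}) (a b : R) :
  partial_x (Ham F) a b = F^`().[a].
Proof.
rewrite /partial_x derive1E.
have H : is_derive a 1 (fun u => Ham F u b) (0 + F^`().[a]).
  exact: (is_deriveD (is_derive_cst (2^-1 * b ^+ 2) a 1) (is_derive_poly F a)).
by rewrite derive_val add0r.
Qed.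

Lemma partial_y_Ham {R : realType} (F : {poly R}) (a b : R) :
  partial_y (Ham F) a b = b.
Proof.
rewrite /partial_y derive1E.
have H : is_derive b 1 (fun v => Ham F a v) b.
  rewrite /Ham; apply: is_derive_eq.
  by rewrite /GRing.scale/=; field.
by rewrite derive_val.
Qed.

Lemma annulus_periodic_orbit {R : realType} (F : {poly R}) (gamma : R -> R * R)
    (T h : R) :
  hamiltonian_solution (Ham F) gamma -> minimal_period gamma T ->
  Defs.orbit gamma `<=` [set z | Ham F z.1 z.2 = h] ->
  periodic_orbit F (fun t => (gamma t).1) (fun t => (gamma t).2) T h.
Proof.
move=> sol [T0 per minT] lev; split => //.
- by move=> t; have [] := sol t; rewrite partial_y_Ham.
- by move=> t; have [_] := sol t; rewrite partial_x_Ham.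
- by move=> t; rewrite per.
- by move=> t; rewrite per.
(* Half of the least period is not a period. *)
- have [|t Ht] := minT (T / 2).
    by rewrite divr_gt0//= ltr_pdivrMr// mulr_natr mulr2n ltrDl.
  by exists (t + T / 2), t; rewrite -!surjective_pairing.
- by move=> t; apply: lev; exists t.
Qed.

Lemma line_integral_time {R : realType} (F : {poly R}) (gamma : R -> R * R)
    (T h : R) (S : set (R * R)) (f g : R -> R -> R) :
  periodic_orbit F (fun t => (gamma t).1) (fun t => (gamma t).2) T h ->
  line_integral gamma T S f g =
  \int[lebesgue_measure]_(t in `[0, T] `&` gamma @^-1` S)
    (f (gamma t).1 (gamma t).2 * (gamma t).2 -
     g (gamma t).1 (gamma t).2 * F^`().[(gamma t).1]).
Proof.
move=> po; apply: eq_Rintegral => t _; rewrite !derive1E.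
have H1 := orbit_dx po t; have H2 := orbit_dy po t.
by rewrite !derive_val mulrN.
Qed.

(** * Moments of a periodic orbit *)

Lemma horner2_coef {R : comNzRingType} (Q : {poly {poly R}}) (x y : R) :
  Q.[x, y] = \sum_(i < size Q) \sum_(j < size Q`_i) Q`_i`_j * (x ^+ i * y ^+ j).
Proof.
rewrite (horner_coef Q) horner_sum; apply: eq_bigr => i _.
rewrite hornerM -polyC_exp hornerC horner_coef mulr_suml; apply: eq_bigr => j _.
by rewrite -mulrA [y ^+ j * _]mulrC.
Qed.

Lemma is_derive_unique {R : realType} (f : R -> R) (t a b : R) :
  is_derive t 1 f a -> is_derive t 1 f b -> a = b.
Proof. by move=> [_ <-] [_ <-]. Qed.

Lemma partial_x_monomial {R : realType} i j (a b : R) :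
  partial_x (monomial i j) a b = i%:R * a ^+ i.-1 * b ^+ j.
Proof.
rewrite /partial_x derive1E /monomial.
have H : is_derive a 1 (fun u : R => u ^+ i) (i%:R * a ^+ i.-1).
  have -> : (fun u : R => u ^+ i) = id ^+ i by apply/funext => s; rewrite exprfctE.
  by apply: is_derive_eq; rewrite /GRing.scale/= mulr1.
have H2 := @is_deriveM _ _ _ (cst (b ^+ j)) a 1 _ _ H (is_derive_cst _ _ _).
have H3 : is_derive a 1 (fun u => u ^+ i * b ^+ j) (i%:R * a ^+ i.-1 * b ^+ j).
  by apply: is_derive_eq H2 _; rewrite /GRing.scale/=; ring.
by rewrite derive_val.
Qed.

Lemma partial_y_monomial {R : realType} i j (a b : R) :
  partial_y (monomial i j) a b = a ^+ i * (j%:R * b ^+ j.-1).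
Proof.
have := partial_x_monomial j i b a; rewrite /partial_x /partial_y /monomial.
rewrite mulrC => <-; congr (derive1 _ _); apply/funext => v; exact: mulrC.
Qed.

Section MomentDefs.
Context {R : realType} (F : {poly R}) (x y : R -> R) (T : R).

Definition moment (S : set R) (i j : nat) : R :=
  \int[lebesgue_measure]_(t in `[0, T] `&` S) (x t ^+ i * y t ^+ j).

Definition dmonomial (i j : nat) (t : R) : R :=
  i%:R * (x t ^+ i.-1 * y t ^+ j.+1) -
  j%:R * (x t ^+ i * y t ^+ j.-1 * F^`().[x t]).

(** This is [K_{i,j}]. When the times in the integral form a single arc, it is
the value of [x^i y^j] at the end of the arc minus the one at its start. *)
Definition endpoint_diff (theta c : R) i j : R :=
  \int[lebesgue_measure]_(t in `[0, T] `&`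
    [set t | 0 < sep_line theta c (x t) (y t)]) dmonomial i j t.

End MomentDefs.

Section OrbitMoments.
Context {R : realType} {F : {poly R}} {x y : R -> R} {T h : R}.
Context (po : periodic_orbit F x y T h).
Context {n : nat} (n2 : (2 <= n)%N) (sF : size F = n.+1).
Notation mu := (@lebesgue_measure R).
Notation moment := (moment x y T).
Notation dmonomial := (dmonomial F x y).

Let T0 : 0 < T := orbit_period_gt0 po.
Let x' := orbit_dx po.
Let y' := orbit_dy po.
Let xT : x T = x 0. Proof. by rewrite -[RHS](orbit_xT po) add0r. Qed.
Let yT : y T = y 0. Proof. by rewrite -[RHS](orbit_yT po) add0r. Qed.
Let level := orbit_level po.
Let cy := continuous_orbit_y po.

Lemma is_derive_monomial i j (t : R) :
  is_derive t 1 (fun s => x s ^+ i * y s ^+ j) (dmonomial i j t).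
Proof.
have dX (f df : R -> R) k : (forall s : R, is_derive s 1 f (df s)) ->
    is_derive t 1 (fun s => f s ^+ k) (k%:R * f t ^+ k.-1 * df t).
  move=> f'; have -> : (fun s => f s ^+ k) = f ^+ k.
    by apply/funext => s; rewrite exprfctE.
  exact: is_deriveX.
apply: is_derive_eq (@is_deriveM _ _ _ _ t 1 _ _ (dX _ _ i x') (dX _ _ j y')) _.
by rewrite /GRing.scale/= /dmonomial [y t ^+ j.+1]exprS; ring.
Qed.

Lemma continuous_monomial i j : continuous (fun t => x t ^+ i * y t ^+ j).
Proof. exact: continuous_of_derive (is_derive_monomial i j). Qed.

Lemma dF_coef a : F^`().[a] = \sum_(k < n) F^`()`_k * a ^+ k.
Proof.
apply: horner_coef_wide; have := lt_size_deriv (p := F).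
by rewrite -size_poly_eq0 sF; apply.
Qed.

Lemma F_coef a : F.[a] = \sum_(k < n.+1) F`_k * a ^+ k.
Proof. by apply: horner_coef_wide; rewrite sF. Qed.

Lemma dmonomial_coef i j t : dmonomial i j t =
  i%:R * (x t ^+ i.-1 * y t ^+ j.+1) -
  j%:R * \sum_(k < n) F^`()`_k * (x t ^+ (i + k) * y t ^+ j.-1).
Proof.
rewrite /dmonomial dF_coef mulr_sumr; congr (_ - _ * _); apply: eq_bigr => k _.
by rewrite exprD; ring.
Qed.

Lemma y_sqr t : y t ^+ 2 = 2 * h - 2 * F.[x t].
Proof. by rewrite -(level t) /Ham; field. Qed.

Lemma continuous_lincomb m (a : nat -> R) (i j : nat -> nat) :
  continuous (fun t => \sum_(k < m) a k * (x t ^+ i k * y t ^+ j k)).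
Proof.
apply: (continuous_sum m (fun k t => a k * (x t ^+ i k * y t ^+ j k))) => k.
by apply: continuous_mulc; exact: continuous_monomial.
Qed.

Section TimeSet.
Context (S : set R) (mS : measurable S).

Let mD : measurable (`[0, T] `&` S). Proof. exact: measurableI. Qed.
Let iS (f : R -> R) : continuous f -> mu.-integrable (`[0, T] `&` S) (EFin \o f).
Proof. by move=> cf; exact: integrable_period. Qed.

Lemma integral_lincomb m (a : nat -> R) (i j : nat -> nat) :
  \int[mu]_(t in `[0, T] `&` S) (\sum_(k < m) a k * (x t ^+ i k * y t ^+ j k))
  = \sum_(k < m) a k * moment S (i k) (j k).
Proof.
rewrite (integral_period_sum _ _ m
  (fun k t => a k * (x t ^+ i k * y t ^+ j k)) mS); last first.
  by move=> k; apply: continuous_mulc; exact: continuous_monomial.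
apply: eq_bigr => k _; rewrite RintegralZl//; apply: iS.
exact: continuous_monomial.
Qed.

Lemma moment_level i j : moment S i j.+2 =
  2 * h * moment S i j - 2 * \sum_(k < n.+1) F`_k * moment S (i + k) j.
Proof.
rewrite -integral_lincomb -RintegralZl//; last first.
  apply: iS; exact: continuous_monomial.
rewrite -RintegralZl//; last by apply: iS; exact: continuous_lincomb.
rewrite -RintegralB//; first last.
- by apply: iS; apply: continuous_mulc; exact: continuous_lincomb.
- by apply: iS; apply: continuous_mulc; exact: continuous_monomial.
apply: eq_Rintegral => t _.
rewrite -addn2 exprD y_sqr F_coef.
rewrite (_ : \sum_(k < n.+1) F`_k * (x t ^+ (i + k) * y t ^+ j) =
  (\sum_(k < n.+1) F`_k * x t ^+ k) * (x t ^+ i * y t ^+ j)); first by ring.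
by rewrite mulr_suml; apply: eq_bigr => k _; rewrite exprD; ring.
Qed.

Lemma integral_dmonomial i j : \int[mu]_(t in `[0, T] `&` S) dmonomial i j t =
  i%:R * moment S i.-1 j.+1
  - j%:R * \sum_(k < n) F^`()`_k * moment S (i + k) j.-1.
Proof.
under eq_Rintegral do rewrite dmonomial_coef.
have cl := continuous_lincomb n (fun k => F^`()`_k) (fun k => i + k)%N (fun=> j.-1).
have cm := continuous_monomial i.-1 j.+1.
rewrite RintegralB//; [|exact: iS _ (continuous_mulc _ _ cm)
                       |exact: iS _ (continuous_mulc _ _ cl)].
rewrite !RintegralZl//; [|exact: iS _ cl|exact: iS _ cm].
by rewrite (integral_lincomb n (fun k => F^`()`_k) (fun k => i + k)%N (fun=> j.-1)).
Qed.

(** The form [Q dx - P dy] reads [(Q y + P F'(x)) dt] along the orbit. *)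
Lemma integral_form (P Q : {poly {poly R}}) :
  \int[mu]_(t in `[0, T] `&` S) (Q.[x t, y t] * y t + P.[x t, y t] * F^`().[x t]) =
  \sum_(i < size Q) \sum_(j < size Q`_i) Q`_i`_j * moment S i j.+1 +
  \sum_(i < size P) \sum_(j < size P`_i)
    P`_i`_j * \sum_(k < n) F^`()`_k * moment S (i + k) j.
Proof.
pose fQ i t := \sum_(j < size Q`_i) Q`_i`_j * (x t ^+ i * y t ^+ j.+1).
pose fP i j t := \sum_(k < n) (P`_i`_j * F^`()`_k) * (x t ^+ (i + k) * y t ^+ j).
have cQ i : continuous (fQ i).
  exact: (continuous_lincomb _ (fun j => Q`_i`_j) (fun=> i) (fun j => j.+1)).
have cP i j : continuous (fP i j).
  exact: (continuous_lincomb n (fun k => P`_i`_j * F^`()`_k)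
    (fun k => i + k)%N (fun=> j)).
have cP2 i : continuous (fun t => \sum_(j < size P`_i) fP i j t).
  exact: (continuous_sum _ (fP i)).
transitivity (\int[mu]_(t in `[0, T] `&` S)
    (\sum_(i < size Q) fQ i t + \sum_(i < size P) \sum_(j < size P`_i) fP i j t)).
  apply: eq_Rintegral => t _; rewrite !horner2_coef !mulr_suml.
  congr (_ + _); apply: eq_bigr => i _; rewrite mulr_suml; apply: eq_bigr => j _.
    by rewrite exprS; ring.
  rewrite dF_coef mulr_sumr; apply: eq_bigr => k _.
  by rewrite exprD; ring.
rewrite RintegralD//; first last.
- exact: (iS _ (continuous_sum _ (fun i t => \sum_(j < size P`_i) fP i j t) cP2)).
- exact: (iS _ (continuous_sum _ fQ cQ)).
rewrite (integral_period_sum _ _ _ fQ mS)//.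
rewrite (integral_period_sum _ _ _
  (fun i t => \sum_(j < size P`_i) fP i j t) mS)//.
congr (_ + _); apply: eq_bigr => i _.
  exact: (integral_lincomb _ (fun j => Q`_i`_j) (fun=> i) (fun j => j.+1)).
rewrite (integral_period_sum _ _ _ (fP i) mS)//; apply: eq_bigr => j _.
rewrite (integral_lincomb n (fun k => P`_i`_j * F^`()`_k)
    (fun k => i + k)%N (fun=> j)).
by rewrite mulr_sumr; apply: eq_bigr => k _; rewrite mulrA.
Qed.

End TimeSet.

Lemma integral_dmonomial_period i j : \int[mu]_(t in `[0, T]) dmonomial i j t = 0.
Proof.
apply: (integral_derivative_period _ (fun t => x t ^+ i * y t ^+ j)) => //.
- exact: is_derive_monomial.
- have c2 := continuous_poly_orbit po F^`().
  move=> t; apply: cvgB; apply: cvgM; try exact: cvg_cst.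
    exact: continuous_monomial.
  apply: cvgM; last exact: c2.
  exact: continuous_monomial.
- by rewrite xT yT.
Qed.

(** The derivative of the identity [(y^2/2 + F(x)) x^i y^j = h x^i y^j]. *)
Lemma dmonomial_level i j t :
  2^-1 * dmonomial i j.+2 t + \sum_(k < n.+1) F`_k * dmonomial (i + k) j t =
  h * dmonomial i j t.
Proof.
pose f k s := F`_k * (x s ^+ (i + k) * y s ^+ j).
have f' k : is_derive t 1 (f k) (F`_k * dmonomial (i + k) j t).
  have H := is_derive_monomial (i + k) j t.
  by apply: is_derive_eq; rewrite /GRing.scale/=.
have g' : is_derive t 1 (fun s => 2^-1 * (x s ^+ i * y s ^+ j.+2))
    (2^-1 * dmonomial i j.+2 t).
  have H := is_derive_monomial i j.+2 t.
  by apply: is_derive_eq; rewrite /GRing.scale/=.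
have l' : is_derive t 1 (fun s => h * (x s ^+ i * y s ^+ j)) (h * dmonomial i j t).
  have H := is_derive_monomial i j t.
  by apply: is_derive_eq; rewrite /GRing.scale/=.
have := is_deriveD g' (@is_derive_sum _ _ _ n.+1 (fun k => f k) t 1 _ (fun k => f' k)).
move=> /is_derive_unique; apply; move: l'; congr (is_derive _ _ _ _).
apply/funext => s; rewrite fctE fct_sumE /f.
rewrite -[j.+2]addn2 exprD y_sqr F_coef.
rewrite (_ : \sum_(k < n.+1) F`_k * (x s ^+ (i + k) * y s ^+ j) =
  (\sum_(k < n.+1) F`_k * x s ^+ k) * (x s ^+ i * y s ^+ j)); first by field.
by rewrite mulr_suml; apply: eq_bigr => k _; rewrite exprD; ring.
Qed.

Section Arc.
Context (theta c : R).
Notation endpoint_diff := (endpoint_diff F x y T theta c).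
Let g t := sep_line theta c (x t) (y t).
Let dg t := sin theta * y t + cos theta * F^`().[x t].

Let cg : continuous g. Proof. exact: continuous_sep_line po theta c. Qed.

Let g' (t : R) : is_derive t 1 g (dg t).
Proof.
have Hx := x' t; have Hy := y' t; rewrite /g /sep_line.
by apply: is_derive_eq; rewrite /GRing.scale/= /dg; ring.
Qed.

Let cdmonomial i j : continuous (dmonomial i j).
Proof.
have c2 := continuous_poly_orbit po F^`().
move=> t; apply: cvgB; apply: cvgM; try exact: cvg_cst.
  exact: continuous_monomial.
by apply: cvgM; [exact: continuous_monomial|exact: c2].
Qed.

Let mpos : measurable [set t | 0 < g t]. Proof. exact: measurable_pos_set. Qed.

Lemma endpoint_diff_level i j :
  2^-1 * endpoint_diff i j.+2 + \sum_(k < n.+1) F`_k * endpoint_diff (i + k) j =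
  h * endpoint_diff i j.
Proof.
rewrite /endpoint_diff -[RHS]RintegralZl//;
  [|exact: measurableI|exact: integrable_period].
have cS k : continuous (fun t => F`_k * dmonomial (i + k) j t).
  exact: continuous_mulc (cdmonomial _ _).
have -> : \sum_(k < n.+1) F`_k * \int[mu]_(t in `[0, T] `&` [set t | 0 < g t])
      dmonomial (i + k) j t =
    \int[mu]_(t in `[0, T] `&` [set t | 0 < g t])
      (\sum_(k < n.+1) F`_k * dmonomial (i + k) j t).
  rewrite (integral_period_sum _ _ n.+1
    (fun k t => F`_k * dmonomial (i + k) j t))//.
  apply: eq_bigr => k _; rewrite RintegralZl//; first exact: measurableI.
  exact: integrable_period.
rewrite -RintegralZl//; [|exact: measurableI|exact: integrable_period].
rewrite -RintegralD//; first last.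
- exact: (integrable_period _ _ _ (continuous_sum n.+1
    (fun k t => F`_k * dmonomial (i + k) j t) cS)).
- by apply: integrable_period => //; apply: continuous_mulc.
- exact: measurableI.
by apply: eq_Rintegral => t _; exact: dmonomial_level.
Qed.

(** The function [x^i y^j L(x, y)] vanishes at both ends of the arc. *)
Lemma endpoint_diff_line i j :
  sin theta * endpoint_diff i.+1 j =
  sin theta * c * endpoint_diff i j + cos theta * endpoint_diff i j.+1.
Proof.
have mD : measurable (`[0, T] `&` [set t | 0 < g t]) by exact: measurableI.
have iD i' j' a : mu.-integrable (`[0, T] `&` [set t | 0 < g t])
    (EFin \o (fun t => a * dmonomial i' j' t)).
  by apply: integrable_period => //; exact: continuous_mulc.
apply/eqP; rewrite -subr_eq0; apply/eqP.
rewrite /endpoint_diff -!RintegralZl//; try by exact: integrable_period.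
rewrite -RintegralD// -RintegralB//; last first.
  by apply: integrable_period => // t; apply: cvgD; exact: continuous_mulc.
have cdg : continuous dg.
  have c2 := continuous_poly_orbit po F^`().
  move=> t; apply: cvgD; apply: cvgM; try exact: cvg_cst.
  - exact: cy.
  - exact: c2.
rewrite -[RHS](@integral_pos_set_prod _ T g dg (fun t => x t ^+ i * y t ^+ j)
  (dmonomial i j))//; first last.
- by rewrite xT yT.
- exact: is_derive_monomial.
- by rewrite /g xT yT.
apply: eq_Rintegral => t _; rewrite /g /dg /sep_line /dmonomial.
by case: i => [|i]; case: j => [|j]; rewrite /= ?exprS ?expr0; ring.
Qed.

End Arc.

Lemma moment_split theta c i j :
  moment setT i j =
    moment [set t | 0 < sep_line theta c (x t) (y t)] i j +
    moment [set t | sep_line theta c (x t) (y t) < 0] i j.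
Proof.
have cg := continuous_sep_line po theta c.
have cm := continuous_monomial i j.
have mz : measurable (`[0, T] `&` [set t | sep_line theta c (x t) (y t) = 0]).
  by apply: measurableI => //; exact: (measurable_zero_set _ cg).
rewrite /moment setIT (integral_sign_split T _ _ cg cm).
rewrite [X in _ + X](_ : _ = 0) ?addr0// /Rintegral null_set_integral//.
- apply/measurable_EFinP; apply: measurable_funTS.
  exact: continuous_measurable_fun.
- by apply: measure_negligible => //; exact: (negligible_on_line po n).
Qed.

End OrbitMoments.

(** * Reduction of the moments and of the endpoint terms *)

(** [V] is a module over the polynomials in [h], and it only sees the values of
functions on the range [D] of the parameter. *)
Record poly_submodule {R : realType} (D : R -> Prop) (V : (R -> R) -> Prop) := {
  submod0 : V (fun=> 0);
  submodD : forall f g, V f -> V g -> V (fun h => f h + g h);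
  submodZ : forall (a : {poly R}) f, V f -> V (fun h => a.[h] * f h);
  submod_ext : forall f g, V f -> (forall h, D h -> f h = g h) -> V g }.

Arguments submod0 {R D V}.
Arguments submodD {R D V} _ {f g}.
Arguments submodZ {R D V} _ a {f}.
Arguments submod_ext {R D V} _ {f} g.

Section PolySubmodule.
Context {R : realType} {D : R -> Prop} {V : (R -> R) -> Prop}.
Context (subV : poly_submodule D V).
Implicit Types f g : R -> R.

Lemma submodZc a f : V f -> V (fun h => a * f h).
Proof.
move=> Vf; apply: (submod_ext subV _ (submodZ subV a%:P Vf)) => h _.
by rewrite hornerC.
Qed.

Lemma submodZh f : V f -> V (fun h => h * f h).
Proof.
move=> Vf; apply: (submod_ext subV _ (submodZ subV 'X Vf)) => h _.
by rewrite hornerX.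
Qed.

Lemma submodB f g : V f -> V g -> V (fun h => f h - g h).
Proof.
move=> Vf Vg; apply: (submod_ext subV _ (submodD subV Vf (submodZc (-1) g Vg))).
by move=> h _; rewrite mulN1r.
Qed.

Lemma submod_sum m (f : nat -> R -> R) : (forall k, (k < m)%N -> V (f k)) ->
  V (fun h => \sum_(k < m) f k h).
Proof.
elim: m => [|m IH] Vf.
  by apply: (submod_ext subV _ (submod0 subV)) => h _; rewrite big_ord0.
apply: (submod_ext subV _ (submodD subV (IH _) (Vf m (ltnSn m)))).
  by move=> k km; apply: Vf; rewrite ltnS ltnW.
by move=> h _; rewrite big_ord_recr.
Qed.

Lemma submod_divc a f : a != 0 -> V (fun h => a * f h) -> V f.
Proof.
move=> a0 Vaf; apply: (submod_ext subV _ (submodZc a^-1 _ Vaf)) => h _.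
by rewrite mulKf.
Qed.

End PolySubmodule.
Arguments submodZc {R D V} _ a {f}.
Arguments submodZh {R D V} _ {f}.
Arguments submodB {R D V} _ {f g}.
Arguments submod_sum {R D V} _ m f.
Arguments submod_divc {R D V} _ a {f}.

Section Reduction.
Context {R : realType} {D : R -> Prop} {V : (R -> R) -> Prop}.
Context (subV : poly_submodule D V).
Context (n : nat) (n2 : (2 <= n)%N) (F : {poly R}) (sF : size F = n.+1).

Section Moments.
Context (m : nat -> nat -> R -> R).
Context (m_level : forall i j h, D h -> m i j.+2 h =
  2 * h * m i j h - 2 * \sum_(k < n.+1) F`_k * m (i + k)%N j h).
Context (m_exact : forall i j, V (fun h =>
  i%:R * m i.-1 j.+1 h - j%:R * \sum_(k < n) F^`()`_k * m (i + k)%N j.-1 h)).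
Context (m_base : forall i, (i < n.-1)%N -> V (m i 2)).

(** The moment [m i 1] is the integral of [d(x^(i+1)) / (i+1)]. *)
Lemma submod_moment1 i : V (m i 1).
Proof.
have := m_exact i.+1 0; move=> H.
apply: (submod_divc subV (i.+1%:R)); first by rewrite pnatr_eq0.
by apply: (submod_ext subV _ H) => h _; rewrite mul0r subr0.
Qed.

(** For [l = i - (n-1) >= 0], the integral of [d(x^l y^3)] is
[l m (l-1) 4 - 3 Sum_k F'_k m (l+k) 2]. Replacing [y^4] by
[y^2 (2 h - 2 F(x))] leaves moments [m k 2] with [k <= i], and [m i 2] itself
has the coefficient [- (2 l + 3 n) F_n]. *)
Lemma submod_moment2 i : V (m i 2).
Proof.
elim/ltn_ind: i => i IH.
have [/m_base//|] := ltnP i n.-1.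
move=> /subnK; set l := (i - n.-1)%N => il.
have Fn0 := lead_coef_neq0 _ _ sF.
(* The factor l covers the case l = 0, where l.-1 is not l - 1. *)
have low k : (k < n)%N -> V (fun h => l%:R * m (l.-1 + k)%N 2 h).
  move=> kn; have [l0|l0] := posnP l.
    by apply: (submod_ext subV _ (submod0 subV)) => h _; rewrite l0 mul0r.
  by apply: (submodZc subV); apply: IH; lia.
have low0 : V (fun h => l%:R * m l.-1 2 h).
  by have := low 0%N; rewrite addn0; apply; lia.
have lowF : V (fun h => \sum_(k < n) F`_k * (l%:R * m (l.-1 + k)%N 2 h)).
  apply: (submod_sum subV _ (fun k h => F`_k * (l%:R * m (l.-1 + k)%N 2 h))).
  by move=> k kn; apply: (submodZc subV); exact: low.
have lowdF : V (fun h => \sum_(k < n.-1) F^`()`_k * m (l + k)%N 2 h).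
  apply: (submod_sum subV _ (fun k h => F^`()`_k * m (l + k)%N 2 h)).
  by move=> k kn; apply: (submodZc subV); apply: IH; lia.
apply: (submod_divc subV (- ((2 * l%:R + 3 * n%:R) * F`_n))).
  rewrite oppr_eq0 mulf_neq0//; have : n%:R > 0 :> R by rewrite ltr0n; lia.
  by have : l%:R >= 0 :> R by []; lra.
apply: (submod_ext subV _ (submodD subV (submodB subV (m_exact l 3)
  (submodZh subV (submodZc subV 2 low0)))
  (submodD subV (submodZc subV 2 lowF) (submodZc subV 3 lowdF)))) => h Dh.
have top : l%:R * m (l.-1 + n)%N 2 h = l%:R * m i 2 h.
  by have [->|l0] := posnP l; [rewrite !mul0r|congr (_ * m _ _ _); lia].
have -> : \sum_(k < n) F`_k * (l%:R * m (l.-1 + k)%N 2 h) =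
    l%:R * \sum_(k < n) F`_k * m (l.-1 + k)%N 2 h.
  by rewrite mulr_sumr; apply: eq_bigr => k _; rewrite mulrCA.
have -> : \sum_(k < n) F^`()`_k * m (l + k)%N 2 h =
    \sum_(k < n.-1) F^`()`_k * m (l + k)%N 2 h + F`_n * n%:R * m i 2 h.
  rewrite -[in LHS](@prednK n) 1?big_ord_recr/= 1?ltnW// il coef_deriv.
  by rewrite prednK 1?ltnW// mulr_natr.
rewrite m_level// big_ord_recr/=.
set S1 := \sum_(k < n) _; set S2 := \sum_(k < n.-1) _.
apply/eqP; rewrite -subr_eq0; apply/eqP.
transitivity (- 2 * F`_n * (l%:R * m (l.-1 + n)%N 2 h - l%:R * m i 2 h)).
  by ring.
by rewrite top subrr mulr0.
Qed.

Lemma submod_moment i j : V (m i j.+1).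
Proof.
have [k] := ubnP j; elim: k i j => // k IH i [_|[_|j jk]].
- exact: submod_moment1.
- exact: submod_moment2.
have low i' : V (m i' j.+1) by apply: IH; lia.
have lowF := submod_sum subV n.+1 (fun k h => F`_k * m (i + k)%N j.+1 h)
  (fun k _ => submodZc subV F`_k (low (i + k)%N)).
apply: (submod_ext subV _ (submodB subV (submodZh subV (submodZc subV 2 (low i)))
  (submodZc subV 2 lowF))) => h Dh.
by rewrite (m_level i j.+1)//; ring.
Qed.

(** The integral of [d(x^i y^(j+1))] differs from [- (j+1)] times this sum by
[i m (i-1) (j+2)]. *)
Lemma submod_moment_dF i j : V (fun h => \sum_(k < n) F^`()`_k * m (i + k)%N j h).
Proof.
apply: (submod_divc subV (j.+1%:R)); first by rewrite pnatr_eq0.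
apply: (submod_ext subV _ (submodB subV
  (submodZc subV i%:R (submod_moment i.-1 j.+1)) (m_exact i j.+1))) => h _.
by rewrite /=; ring.
Qed.

End Moments.

Section Endpoints.
Context (K : nat -> nat -> R -> R).
Implicit Types (p q : {poly R}).
Context (K00 : forall h, K 0 0 h = 0).
Context (K_level : forall i j h, D h ->
  2^-1 * K i j.+2 h + \sum_(k < n.+1) F`_k * K (i + k)%N j h = h * K i j h).

(** On the line [y = 0] the level relation becomes [F(x) = h], of degree [n]
in [x]. *)
Lemma submod_endpoints_horizontal :
  (forall i j h, D h -> K i j.+1 h = 0) ->
  (forall i, (i < n.-1)%N -> V (K i.+1 0)) -> forall i j, V (K i j).
Proof.
move=> Ky base i [|j]; last first.
  by apply: (submod_ext subV _ (submod0 subV)) => h Dh; rewrite Ky.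
elim/ltn_ind: i => -[_|i IH].
  by apply: (submod_ext subV _ (submod0 subV)) => h Dh; rewrite K00.
have [/base//|] := ltnP i n.-1.
move=> ni; set l := (i.+1 - n)%N; have il : (l + n)%N = i.+1 by lia.
apply: (submod_divc subV F`_n); first exact: lead_coef_neq0.
have low := submod_sum subV n (fun k h => F`_k * K (l + k)%N 0 h)
  (fun k kn => submodZc subV F`_k (IH (l + k)%N ltac:(lia))).
have lowl := IH l ltac:(lia).
apply: (submod_ext subV _ (submodB subV (submodZh subV lowl) low)) => h Dh.
by rewrite -K_level// big_ord_recr/= Ky// il; ring.
Qed.

(** The linear extension of ['X^l |-> K 0 l]. *)
Let Phi (q : {poly R}) h := \sum_(l < size q) q`_l * K 0 l h.

Let Phi_widen q N h : (size q <= N)%N -> Phi q h = \sum_(l < N) q`_l * K 0 l h.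
Proof.
move=> qN; rewrite /Phi (big_ord_widen N (fun l => q`_l * K 0%N l h) qN).
rewrite big_mkcond/=; apply: eq_bigr => l _; case: ltnP => // ql.
by rewrite nth_default ?mul0r.
Qed.

Let PhiD p q h : Phi (p + q) h = Phi p h + Phi q h.
Proof.
pose N := maxn (size p) (size q).
rewrite (Phi_widen _ N) ?size_polyD// (Phi_widen p N) ?leq_maxl//.
rewrite (Phi_widen q N) ?leq_maxr// -big_split/=; apply: eq_bigr => l _.
by rewrite coefD mulrDl.
Qed.

Let PhiZ a p h : Phi (a *: p) h = a * Phi p h.
Proof.
rewrite (Phi_widen _ (size p)) ?size_scale_leq// mulr_sumr.
by apply: eq_bigr => l _; rewrite coefZ mulrA.
Qed.

Let Phi_sum (I : Type) (r : seq I) (p : I -> {poly R}) h :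
  Phi (\sum_(k <- r) p k) h = \sum_(k <- r) Phi (p k) h.
Proof.
elim: r => [|k r IH]; last by rewrite !big_cons PhiD IH.
by rewrite !big_nil /Phi size_poly0 big_ord0.
Qed.

Let PhiXn l h : Phi 'X^l h = K 0 l h.
Proof.
rewrite /Phi size_polyXn big_ord_recr/= coefXn eqxx mul1r big1 ?add0r// => k _.
by rewrite coefXn ltn_eqF// mul0r.
Qed.

(** Substituting [x = c + kappa y], the level relation becomes [W(y) = h] with
[W = y^2/2 + F(c + kappa y)]. The degree [d] of [W] is 2 for [kappa = 0] and
[n] otherwise; for [n = 2] the leading coefficient [1/2 + F_2 kappa^2] is
nonzero because [F_2 > 0]. *)
Lemma submod_endpoints_graph kappa c :
  (forall i j h, D h -> K i.+1 j h = c * K i j h + kappa * K i j.+1 h) ->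
  (n = 2%N -> 0 < F`_2) ->
  (forall i, (i < n.-1)%N -> V (K 0 i.+1)) -> forall i j, V (K i j).
Proof.
move=> Kline F2 base.
pose x : {poly R} := kappa *: 'X + c%:P.
have KPhi i j h : D h -> K i j h = Phi ('X^j * x ^+ i) h.
  move=> Dh; elim: i j => [|i IH] j; first by rewrite expr0 mulr1 PhiXn.
  rewrite Kline// !IH -!PhiZ -PhiD; congr (Phi _ h).
  by rewrite !exprS /x -!mul_polyC; ring.
pose W := 2^-1 *: 'X^2 + (F \Po x).
have KW m h : D h -> Phi ('X^m * W) h = h * K 0 m h.
  move=> Dh; rewrite -K_level// -PhiXn -PhiZ /W mulrDr PhiD; congr (_ + _).
    by congr (Phi _ h); rewrite -scalerAr -exprD addn2.
  rewrite comp_polyE mulr_sumr Phi_sum sF; apply: eq_bigr => k _.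
  by rewrite add0n -scalerAr PhiZ -KPhi.
have [d [d2 dn Wd sW]] : exists d, [/\ (2 <= d)%N, (d <= n)%N, W`_d != 0
    & (size W <= d.+1)%N].
  have [k0|k0] := eqVneq kappa 0.
    have WE : W = 2^-1 *: 'X^2 + (F.[c])%:P.
      by rewrite /W /x k0 scale0r add0r comp_polyCr.
    exists 2%N; split=> //.
      by rewrite WE coefD coefZ coefXn coefC/= addr0 mulr1 invr_eq0 pnatr_eq0.
    rewrite WE (leq_trans (size_polyD _ _))// geq_max size_polyC.
    by rewrite (leq_trans (size_scale_leq _ _)) ?size_polyXn//; case: (_ != _).
  have xE : size x = 2%N.
    by rewrite /x -mul_polyC size_MXaddC polyC_eq0 (negPf k0)/= size_polyC k0.
  have sFx : size (F \Po x) = n.+1 by rewrite size_comp_poly2.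
  have lx : lead_coef x = kappa.
    by rewrite lead_coefE xE /x coefD coefZ coefX coefC/= mulr1 addr0.
  have Fx : (F \Po x)`_n = F`_n * kappa ^+ n.
    have := lead_coef_comp F (q := x).
    by rewrite xE !lead_coefE sFx sF/= -lead_coefE lx; exact.
  exists n; split=> //; last first.
    rewrite (leq_trans (size_polyD _ _))// geq_max sFx leqnn andbT.
    by rewrite (leq_trans (size_scale_leq _ _))// size_polyXn ltnS.
  rewrite coefD coefZ coefXn Fx.
  have [n_2|n_2] := eqVneq n 2%N; last first.
    by rewrite mulr0 add0r mulf_neq0 ?expf_neq0//; exact: lead_coef_neq0.
  rewrite mulr1 gt_eqF// addr_gt0 ?invr_gt0 ?ltr0n//.
  by rewrite n_2 mulr_gt0 ?F2// exprn_even_gt0.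
have K0 j : V (K 0 j).
  elim/ltn_ind: j => j IH.
  have [jd|dj] := ltnP j d.
    case: j jd {IH} => [|j] jd; last by apply: base; lia.
    by apply: (submod_ext subV _ (submod0 subV)) => h Dh; rewrite K00.
  have jE : ((j - d) + d)%N = j by rewrite subnK.
  apply: (submod_divc subV W`_d) => //.
  have low := submod_sum subV d (fun k h => W`_k * K 0%N (j - d + k)%N h)
    (fun k kd => submodZc subV W`_k (IH (j - d + k)%N ltac:(lia))).
  have lowl := IH (j - d)%N ltac:(lia).
  apply: (submod_ext subV _ (submodB subV (submodZh subV lowl) low)) => h Dh.
  rewrite -KW//.
  have -> : 'X^(j - d) * W = \sum_(k < d.+1) W`_k *: 'X^(j - d + k).
    rewrite -{1}(coefK W) poly_def (big_ord_widen _ (fun k => W`_k *: 'X^k) sW).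
    rewrite big_mkcond/= mulr_sumr; apply: eq_bigr => k _; case: ltnP => kW.
      by rewrite exprD scalerAr.
    by rewrite nth_default// mulr0 scale0r.
  rewrite Phi_sum big_ord_recr/= PhiZ PhiXn jE.
  under eq_bigr do rewrite PhiZ PhiXn.
  by ring.
move=> i j.
have Vsum := submod_sum subV (size ('X^j * x ^+ i))
   (fun k h => ('X^j * x ^+ i)`_k * K 0%N k h)
   (fun k _ => submodZc subV _ (K0 k)).
by apply: (submod_ext subV _ Vsum) => h Dh; rewrite KPhi.
Qed.

End Endpoints.
End Reduction.

(** * The representation *)

Section Representable.
Context {R : realType} (D : R -> Prop) (m : nat) (B1 B2 B3 : nat -> R -> R).

Definition representable (M : R -> R) := exists p q s : nat -> {poly R},
  forall h, D h -> M h = \sum_(0 <= i < m) (p i).[h] * B1 i h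
    + \sum_(0 <= i < m) (q i).[h] * B2 i h
    + \sum_(0 <= i < m) (s i).[h] * B3 i h.

Lemma representable_submodule : poly_submodule D representable.
Proof.
split.
- exists (fun=> 0), (fun=> 0), (fun=> 0) => h _.
  by rewrite !big1 ?addr0// => i _; rewrite horner0 mul0r.
- move=> f g [p1 [q1 [s1 H1]]] [p2 [q2 [s2 H2]]].
  exists (fun i => p1 i + p2 i), (fun i => q1 i + q2 i), (fun i => s1 i + s2 i).
  move=> h Dh; rewrite H1// H2//.
  have sumD (a b : nat -> {poly R}) (u : nat -> R -> R) :
    \sum_(0 <= i < m) (a i + b i).[h] * u i h =
    \sum_(0 <= i < m) (a i).[h] * u i h + \sum_(0 <= i < m) (b i).[h] * u i h.
    by rewrite -big_split/=; apply: eq_bigr => i _; rewrite hornerD mulrDl.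
  by rewrite !sumD; ring.
- move=> a f [p [q [s H]]].
  exists (fun i => a * p i), (fun i => a * q i), (fun i => a * s i) => h Dh.
  rewrite H// !mulrDr !mulr_sumr.
  by congr (_ + _ + _); apply: eq_bigr => i _; rewrite hornerM mulrA.
- by move=> f g [p [q [s H]]] fg; exists p, q, s => h Dh; rewrite -fg// H.
Qed.

Let sum_delta (u : nat -> R -> R) k h : (k < m)%N ->
  \sum_(0 <= i < m) (if i == k then 1 else 0 : {poly R}).[h] * u i h = u k h.
Proof.
move=> km; rewrite big_mkord (bigD1 (Ordinal km))//= eqxx hornerC mul1r.
rewrite big1 ?addr0// => i; rewrite -val_eqE/= => /negPf ->.
by rewrite horner0 mul0r.
Qed.

Let sum_0 (u : nat -> R -> R) h :
  \sum_(0 <= i < m) (0 : {poly R}).[h] * u i h = 0.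
Proof. by rewrite big1// => i _; rewrite horner0 mul0r. Qed.

Lemma representable_generators k : (k < m)%N ->
  [/\ representable (B1 k), representable (B2 k) & representable (B3 k)].
Proof.
move=> km; split.
- exists (fun i => if i == k then 1 else 0), (fun=> 0), (fun=> 0) => h _.
  by rewrite !sum_0 !addr0 sum_delta.
- exists (fun=> 0), (fun i => if i == k then 1 else 0), (fun=> 0) => h _.
  by rewrite !sum_0 addr0 add0r sum_delta.
- exists (fun=> 0), (fun=> 0), (fun i => if i == k then 1 else 0) => h _.
  by rewrite !sum_0 !add0r sum_delta.
Qed.

End Representable.

Theorem theorem1p1 (R : realType) (n : nat) (hn : (2 <= n)%N)
  (F : {poly R}) (hF : size F = n.+1)
  (alpha beta : \bar R) (gamma : R -> R -> R * R) (T : R -> R)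
  (hann : continuous_period_annulus (Ham F) alpha beta gamma T)
  (theta c : R) (htheta : 0 < theta <= pi)
  (hsplit : forall h : R, (alpha < h%:E < beta)%E ->
     splits (sep_line theta c) (gamma h))
  (Pm Qm Pp Qp : {poly {poly R}}) :
  exists p q s : nat -> {poly R},
    forall h : R, (alpha < h%:E < beta)%E ->
      Mtilde (sep_line theta c) (gamma h) (T h) Pm Qm Pp Qp =
        \sum_(0 <= i < n.-1) (p i).[h] * I_full (gamma h) (T h) i 1
      + \sum_(0 <= i < n.-1)
          (q i).[h] * I_pos (sep_line theta c) (gamma h) (T h) i 1
      + \sum_(0 <= i < n.-1) (s i).[h] * Ktilde theta c (gamma h) (T h) i.
Proof.
pose D h := (alpha < h%:E < beta)%E.
(* The sign of F_2 for n = 2 comes from the existence of a periodic orbit. *)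
have [[h0 Dh0]|Dempty] := pselect (exists h, D h); last first.
  exists (fun=> 0), (fun=> 0), (fun=> 0) => h Dh.
  by case: Dempty; exists h.
pose V := representable D n.-1 (fun i h => I_full (gamma h) (T h) i 1)
  (fun i h => I_pos (sep_line theta c) (gamma h) (T h) i 1)
  (fun i h => Ktilde theta c (gamma h) (T h) i).
change (V (fun h => Mtilde (sep_line theta c) (gamma h) (T h) Pm Qm Pp Qp)).
have subV : poly_submodule D V by exact: representable_submodule.
have Vgen k : (k < n.-1)%N ->
    [/\ V (fun h => I_full (gamma h) (T h) k 1),
        V (fun h => I_pos (sep_line theta c) (gamma h) (T h) k 1)
      & V (fun h => Ktilde theta c (gamma h) (T h) k)].
  exact: representable_generators.
pose x h t := (gamma h t).1; pose y h t := (gamma h t).2.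
have po h : D h -> periodic_orbit F (x h) (y h) (T h) h.
  by move=> /(proj1 hann)[]; exact: annulus_periodic_orbit.
pose pos h := [set t | 0 < sep_line theta c (x h t) (y h t)].
pose neg h := [set t | sep_line theta c (x h t) (y h t) < 0].
have mpos h : D h -> measurable (pos h).
  by move=> /po poh; exact: measurable_pos_set (continuous_sep_line poh theta c).
have mneg h : D h -> measurable (neg h).
  by move=> /po poh; exact: measurable_neg_set (continuous_sep_line poh theta c).
pose K i j h := endpoint_diff F (x h) (y h) (T h) theta c i j.
have KE i j h : D h -> K_pos (sep_line theta c) (gamma h) (T h) i j = K i j h.
  move=> /po poh; rewrite /K_pos /exact_integral (line_integral_time F _ _ h)//.
  apply: eq_Rintegral => t _.
  by rewrite partial_x_monomial partial_y_monomial /dmonomial /x /y exprSr; ring.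
have VK : forall i j, V (K i j).
  have K00 h : K 0%N 0%N h = 0.
    rewrite /K /endpoint_diff (@eq_Rintegral _ _ _ _ _ (fun=> 0)).
      by rewrite /Rintegral integral0.
    by move=> t _; rewrite /dmonomial !mul0r subr0.
  have Klev i j h : D h ->
      2^-1 * K i j.+2 h + \sum_(k < n.+1) F`_k * K (i + k)%N j h = h * K i j h.
    by move=> /po poh; exact: (endpoint_diff_level poh).
  have Kline i j h : D h -> sin theta * K i.+1 j h =
      sin theta * c * K i j h + cos theta * K i j.+1 h.
    by move=> /po poh; exact: (endpoint_diff_line poh).
  have [thpi|thpi] := eqVneq theta pi.
    refine (submod_endpoints_horizontal subV n hn F hF K K00 Klev _ _).
      move=> i j h Dh; have := Kline i j h Dh.
      rewrite thpi sinpi cospi !mul0r add0r mulN1r => /esym/eqP.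
      by rewrite oppr_eq0 => /eqP.
    move=> i /Vgen[_ _ VKi]; apply: (submod_ext subV _ VKi) => h Dh.
    by rewrite /Ktilde thpi eqxx -thpi KE.
  have s0 : sin theta != 0.
    rewrite gt_eqF// sin_gt0_pi// ?in_itv/=.
    by move: htheta => /andP[-> /=]; rewrite le_eqVlt (negPf thpi).
  refine (submod_endpoints_graph subV n hn F hF K K00 Klev
            (cos theta / sin theta) c _ _ _).
  - move=> i j h Dh; apply: (mulfI s0); rewrite Kline//.
    by field.
  - move=> n_2; have F20 : F`_2 != 0 by rewrite -n_2; exact: lead_coef_neq0.
    rewrite lt_neqAle eq_sym F20 leNgt; apply/negP => F2.
    (* Otherwise H is a saddle: F' = 2 F_2 (X + F_1 / (2 F_2)). *)
    apply: (no_periodic_orbit_saddle (po h0 Dh0) (2 * F`_2)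
              (- F`_1 / (2 * F`_2))).
      by rewrite pmulr_rlt0.
    apply/polyP => i; rewrite coef_deriv coefZ coefB coefX coefC.
    case: i => [|[|i]] /=; rewrite ?mulr1n ?subr0 ?mulr1.
    - by field.
    - by rewrite mulr_natl.
    - by rewrite mulr0 nth_default ?mul0rn// hF n_2.
  - move=> i /Vgen[_ _ VKi]; apply: (submod_ext subV _ VKi) => h Dh.
    by rewrite /Ktilde (negPf thpi) KE.
pose mF i j h := moment (x h) (y h) (T h) setT i j.
pose mP i j h := moment (x h) (y h) (T h) (pos h) i j.
pose mN i j h := moment (x h) (y h) (T h) (neg h) i j.
have IE (S : R -> set (R * R)) i h : D h ->
    line_integral (gamma h) (T h) (S h) (monomial i 1) (fun _ _ => 0) =
    moment (x h) (y h) (T h) (gamma h @^-1` S h) i 2.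
  move=> /po poh; rewrite (line_integral_time F _ _ h)//.
  apply: eq_Rintegral => t _; rewrite /monomial /x /y mul0r subr0 expr1.
  by rewrite -mulrA -expr2.
have mF_level i j h : D h -> mF i j.+2 h =
    2 * h * mF i j h - 2 * \sum_(k < n.+1) F`_k * mF (i + k)%N j h.
  by move=> /po poh; exact: (moment_level poh).
have mP_level i j h : D h -> mP i j.+2 h =
    2 * h * mP i j h - 2 * \sum_(k < n.+1) F`_k * mP (i + k)%N j h.
  by move=> Dh; apply: (moment_level (po h Dh)) => //; exact: mpos.
have mF_exact i j : V (fun h => i%:R * mF i.-1 j.+1 h -
    j%:R * \sum_(k < n) F^`()`_k * mF (i + k)%N j.-1 h).
  apply: (submod_ext subV _ (submod0 subV)) => h /po poh.
  by rewrite -(integral_dmonomial poh)// setIT (integral_dmonomial_period poh).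
have mP_exact i j : V (fun h => i%:R * mP i.-1 j.+1 h -
    j%:R * \sum_(k < n) F^`()`_k * mP (i + k)%N j.-1 h).
  apply: (submod_ext subV _ (VK i j)) => h Dh.
  by rewrite -(integral_dmonomial (po h Dh))//; exact: mpos.
have mF_base i : (i < n.-1)%N -> V (mF i 2%N).
  move=> /Vgen[VI _ _]; apply: (submod_ext subV _ VI) => h Dh.
  exact: (IE (fun=> setT)).
have mP_base i : (i < n.-1)%N -> V (mP i 2%N).
  move=> /Vgen[_ VI _]; apply: (submod_ext subV _ VI) => h Dh.
  exact: (IE (fun=> Sigma_pos (sep_line theta c))).
have VF := submod_moment subV n hn F hF mF mF_level mF_exact mF_base.
have VP := submod_moment subV n hn F hF mP mP_level mP_exact mP_base.
have VdF := submod_moment_dF subV n hn F hF mF mF_level mF_exact mF_base.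
have VdP := submod_moment_dF subV n hn F hF mP mP_level mP_exact mP_base.
have mNE i j h : D h -> mN i j h = mF i j h - mP i j h.
  move=> /po poh; rewrite /mF (moment_split poh hn hF theta c).
  by rewrite /mP /mN; ring.
have VN i j : V (mN i j.+1).
  apply: (submod_ext subV _ (submodB subV (VF i j) (VP i j))) => h Dh.
  by rewrite mNE.
have VdN i j : V (fun h => \sum_(k < n) F^`()`_k * mN (i + k)%N j h).
  apply: (submod_ext subV _ (submodB subV (VdF i j) (VdP i j))) => h Dh.
  by rewrite -sumrB; apply: eq_bigr => k _; rewrite mNE//; ring.
have Vform (m : nat -> nat -> R -> R) (P Q : {poly {poly R}}) :
    (forall i j, V (m i j.+1)) ->
    (forall i j, V (fun h => \sum_(k < n) F^`()`_k * m (i + k)%N j h)) ->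
    V (fun h => \sum_(i < size Q) \sum_(j < size Q`_i) Q`_i`_j * m i j.+1 h +
      \sum_(i < size P) \sum_(j < size P`_i)
        P`_i`_j * \sum_(k < n) F^`()`_k * m (i + k)%N j h).
  move=> Vm Vdm; apply: (submodD subV).
  - apply: (submod_sum subV _ (fun i h =>
      \sum_(j < size Q`_i) Q`_i`_j * m i j.+1 h)) => i _.
    apply: (submod_sum subV _ (fun j h => Q`_i`_j * m i j.+1 h)) => j _.
    exact: (submodZc subV).
  - apply: (submod_sum subV _ (fun i h => \sum_(j < size P`_i)
        P`_i`_j * \sum_(k < n) F^`()`_k * m (i + k)%N j h)) => i _.
    apply: (submod_sum subV _ (fun j h =>
        P`_i`_j * \sum_(k < n) F^`()`_k * m (i + k)%N j h)) => j _.
    exact: (submodZc subV).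
apply: (submod_ext subV _ (submodD subV (Vform mN Pm Qm VN VdN)
                                        (Vform mP Pp Qp VP VdP))) => h Dh.
have mp := mpos h Dh; have mn := mneg h Dh; have poh := po h Dh.
rewrite /Mtilde !(line_integral_time F _ _ h)//.
congr (_ + _); rewrite -(integral_form poh)//; apply: eq_Rintegral => t _.
- by rewrite mulNr opprK.
- by rewrite mulNr opprK.
Qed.
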